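(* Let $n\ge 7$. The circulant graph $C_n^{1,3}$ is a square if $n\in\{8,10\}$ and is not a square otherwise.
   Context: For integers $1\le d_1<\dots<d_s\le n/2$, the circulant graph $C_n^{d_1,\dots,d_s}$ has vertex set $\{0,1,\dots,n-1\}$, with $i$ and $j$ adjacent iff $i-j\equiv \pm d_k \pmod n$ for some $1\le k\le s$. All graphs are finite and simple. A partially labeled graph is a graph $H$ together with an injective map $\theta: L\to V(H)$, $L\subseteq\mathbb{N}$, whose image $\theta(L)$ is nonempty and a proper subset of $V(H)$; vertices in $\theta(L)$ are labeled. The square $HH$ is obtained from two disjoint copies of $H$ by identifying each labeled vertex $\theta(\ell)$ of the first copy with $\theta(\ell)$ of the second copy (keeping all edges, merging double edges). A graph $G$ is a square if $G\cong HH$ for some partially labeled graph $H$. *)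

(* Defs.v *)
From HB Require Import structures.
From mathcomp Require Import all_boot finmap.

Set Implicit Arguments.
Unset Strict Implicit.
Unset Printing Implicit Defensive.

Record sgraph := SGraph {
  vertex :> finType;
  adj : rel vertex;
  adj_sym : symmetric adj;
  adj_irr : irreflexive adj
}.

Definition isomorphic (G H : sgraph) : Prop :=
  exists2 f : G -> H, bijective f & forall x y, adj (f x) (f y) = adj x y.

(* The label set L is taken in {fset nat}: it injects into a finite vertex
   set, so it is necessarily finite. *)
Record plgraph := PLGraph {
  plbase :> sgraph;
  label : {fset nat};
  theta : label -> plbase;
  theta_inj : injective theta;
  theta_neq0 : [set theta l | l : label] != set0;
  theta_proper : [set theta l | l : label] \proper [set: plbase]
}.

Section Square.
Variable H : plgraph.

Definition labeled : {set H} := [set theta l | l : label H].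

(* Vertices of HH: the whole first copy of H, and the unlabeled part of the
   second copy; the labeled vertices of the second copy are those of the
   first. *)
Definition sq_vertex : finType := (H + {v : H | v \notin labeled})%type.

Definition copy1 (v : H) : sq_vertex := inl v.

Definition copy2 (v : H) : sq_vertex :=
  if insub v is Some w then inr w else inl v.

Definition sq_adj : rel sq_vertex := fun x y =>
  [exists u : H, exists v : H, adj u v &&
    ((x == copy1 u) && (y == copy1 v) || (x == copy2 u) && (y == copy2 v))].

Lemma copy1_inj : injective copy1.
Proof. by move=> u v []. Qed.

Lemma copy2_inj : injective copy2.
Proof.
move=> u v; rewrite /copy2.
case: insubP => [a _ <-|_]; case: insubP => [b _ <-|_] //.
  by case=> ->.
by case.
Qed.

Lemma sq_adj_sym : symmetric sq_adj.
Proof.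
suff h x y : sq_adj x y -> sq_adj y x by move=> x y; apply/idP/idP; apply: h.
move=> /existsP[u /existsP[v /andP[uv e]]].
apply/existsP; exists v; apply/existsP; exists u.
by rewrite adj_sym uv /= ![(y == _) && _]andbC.
Qed.

Lemma sq_adj_irr : irreflexive sq_adj.
Proof.
move=> x; apply/negbTE/negP => /existsP[u /existsP[v /andP[uv]]].
case/orP => /andP[/eqP-> /eqP].
  by move/copy1_inj => e; rewrite e adj_irr in uv.
by move/copy2_inj => e; rewrite e adj_irr in uv.
Qed.

Definition square : sgraph := SGraph sq_adj_sym sq_adj_irr.

End Square.

Definition is_square (G : sgraph) : Prop :=
  exists H : plgraph, isomorphic G (square H).

Definition circulant_steps (n : nat) (ds : seq nat) : bool :=
  sorted ltn ds && all (fun d => 1 <= d <= n./2) ds.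

Section Circulant.
Variables (n : nat) (ds : seq nat).

(* i - j = d or i - j = - d modulo n, written without subtraction. *)
Definition circ_adj : rel 'I_n := fun i j =>
  has (fun d => (i == j + d %[mod n]) || (i + d == j %[mod n])) ds.

Lemma circ_adj_sym : symmetric circ_adj.
Proof.
move=> i j; apply: eq_has => d.
by rewrite orbC eq_sym [X in _ || X]eq_sym.
Qed.

Hypothesis dsP : circulant_steps n ds.

Lemma circ_adj_irr : irreflexive circ_adj.
Proof.
move=> i; apply/negbTE/hasP => -[d dds].
case/andP: dsP => _ /allP /(_ d dds) /andP[d0 dn].
have n0 : 0 < n by case: (n) i => [[]|].
have ltdn : d < n.
  by apply: leq_ltn_trans dn _; rewrite ltn_half_double -addnn -{1}[n]addn0 ltn_add2l.
have h : (i + 0 == i + d %[mod n]) = false.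
  by rewrite eqn_modDl mod0n modn_small // eq_sym; apply/negbTE; rewrite -lt0n.
by rewrite addn0 in h; rewrite [X in _ || X]eq_sym h.
Qed.

Definition circulant : sgraph := SGraph circ_adj_sym circ_adj_irr.

End Circulant.

Lemma circulant_steps13 (n : nat) : 7 <= n -> circulant_steps n [:: 1; 3].
Proof.
move=> hn; have h3 : 3 <= n./2 by apply: (half_leq hn).
by rewrite /circulant_steps /= h3 (leq_trans _ h3).
Qed.

(* Main.v *)
Require Import Defs.
From HB Require Import structures.
From mathcomp Require Import all_boot finmap.
From mathcomp Require Import zify.

Set Implicit Arguments.
Unset Strict Implicit.
Unset Printing Implicit Defensive.

(** A graph is a square iff it has an involutive automorphism [phi] with a
    fixed point whose moved vertices split into a nonempty set [A] and its
    image, with no edge between the two.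

    In [C_n^{1,3}] with [n >= 7], [n <> 8, 10], two neighbours of a vertex [f]
    have at least three common neighbours iff they differ by [2].  So, if [phi]
    fixes [f], it preserves the path [f-3, f-1, f+1, f+3] and either fixes or
    reverses it.  If it reverses it, then [f-1] and [f+1] lie on different
    sides, so their common neighbour [f+2] is fixed; but then [phi] fixes or
    reverses the path [f-1, f+1, f+3, f+5], whereas it swaps its first two
    vertices.  Hence [phi] fixes all neighbours of each of its fixed points, and
    it is the identity.

    For [n = 8] the graph is [K_{4,4}] and [phi] exchanges two vertices of the
    same part; for [n = 10] it is [K_{5,5}] minus the perfect matching
    [x, x + 5], and [phi] exchanges two pairs of the matching. *)

(** * Squares and mirror involutions *)

(** By [mirror_notin] every vertex of [A] is moved. As [phi] is an involution, preserving edges in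
    one direction makes it an automorphism. *)
Record mirror (G : sgraph) (phi : G -> G) (A : {set G}) : Prop := Mirror {
  mirror_inv : involutive phi;
  mirror_adj : forall x y, adj x y -> adj (phi x) (phi y);
  mirror_notin : forall x, x \in A -> phi x \notin A;
  mirror_cover : forall x, phi x != x -> (x \in A) || (phi x \in A);
  mirror_nadj : forall x y, x \in A -> y \in A -> ~~ adj x (phi y);
  mirror_fix : exists x, phi x = x;
  mirror_moved : exists x, x \in A
}.

Lemma mirror_adjE (G : sgraph) (phi : G -> G) (A : {set G}) :
  mirror phi A -> forall x y, adj (phi x) (phi y) = adj x y.
Proof.
move=> m x y; apply/idP/idP; last exact: (mirror_adj m).
by move/(mirror_adj m); rewrite !(mirror_inv m).
Qed.

Lemma mirror_neq (G : sgraph) (phi : G -> G) (A : {set G}) :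
  mirror phi A -> forall x, x \in A -> phi x != x.
Proof. by move=> m x xA; apply: contraNneq (mirror_notin m xA) => ->. Qed.

Lemma mirror_iso (G G' : sgraph) (phi : G' -> G') (A : {set G'}) :
  isomorphic G G' -> mirror phi A ->
  exists psi : G -> G, exists B : {set G}, mirror psi B.
Proof.
move=> [f [g fK gK] fadj] m.
have gadj x y : adj (g x) (g y) = adj x y by rewrite -fadj !gK.
exists (fun x => g (phi (f x))), (f @^-1: A); split.
- by move=> x; rewrite gK (mirror_inv m) fK.
- by move=> x y xy; rewrite gadj (mirror_adjE m) fadj.
- by move=> x; rewrite !inE gK; apply: mirror_notin.
- move=> x ne; rewrite !inE gK; apply: (mirror_cover m).
  by apply: contraNneq ne => ->; rewrite fK.
- by move=> x y; rewrite !inE -fadj gK; apply: mirror_nadj.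
- by have [x ex] := mirror_fix m; exists (g x); rewrite gK ex.
- by have [x xA] := mirror_moved m; exists (g x); rewrite inE gK.
Qed.

Section SquareMirror.
Variable H : plgraph.

Definition sq_swap (x : square H) : square H :=
  match x with inl v => copy2 v | inr w => inl (val w) end.

Definition sq_side : {set square H} :=
  [set x : square H | if x is inl v then v \notin labeled H else false].

Lemma copy2_labeled (v : H) : v \in labeled H -> copy2 v = inl v.
Proof. by move=> vL; rewrite /copy2 insubF // vL. Qed.

Lemma copy2_val (w : {v : H | v \notin labeled H}) : copy2 (val w) = inr w.
Proof. by rewrite /copy2 valK. Qed.

Lemma sq_swapK : involutive sq_swap.
Proof.
case=> [v|w] /=; last by rewrite copy2_val.
by rewrite /copy2; case: insubP => [u _ <-|vL] //=; rewrite /copy2 insubN.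
Qed.

Lemma sq_mirror : mirror sq_swap sq_side.
Proof.
split; first exact: sq_swapK.
- move=> x y /existsP[u /existsP[v /andP[uv e]]].
  apply/existsP; exists u; apply/existsP; exists v; rewrite uv /=.
  have c1 t : sq_swap (copy2 t) = copy1 t by rewrite -[copy1 t]sq_swapK.
  by case/orP: e => /andP[/eqP-> /eqP->]; rewrite /= ?c1 !eqxx ?orbT.
- by case=> [v|w]; rewrite inE //= => vL; rewrite inE /copy2 insubT.
- case=> [v|w] /= ne; rewrite !inE /=; last by rewrite (valP w).
  by apply/orP; left; apply: contra ne => vL; rewrite copy2_labeled.
- case=> [v|w] [v'|w']; rewrite !inE // => vL vL'; rewrite /= /copy2 insubT.
  (* An edge of the first copy has no end of the form [inr]; one of the second copy meets [inl v]
     only if [v] is labeled. *)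
  apply/negP => /existsP[a /existsP[b /andP[_ /orP[]]]] /andP[/eqP ea /eqP eb].
    by [].
  move: ea; rewrite /copy2; case: insubP => [//|aL [ev]].
  by rewrite -ev vL in aL.
- have /set0Pn[v vL] := theta_neq0 H.
  by exists (inl v); rewrite /= copy2_labeled.
- have /properP[_ [v _ vL]] := theta_proper H.
  by exists (inl v); rewrite inE.
Qed.

End SquareMirror.

(** The labels are the positions in [enum F]; [x0] only serves as the default of [nth]. *)
Lemma labels_of_set (T : finType) (F : {set T}) : F != set0 ->
  exists L : {fset nat}, exists2 th : L -> T,
    injective th & [set th l | l : L] = F.
Proof.
case/set0Pn => x0 x0F.
pose L : {fset nat} := [fset i | i in iota 0 #|F|]%fset.
have LP (l : L) : val l < #|F|.
  by have := valP l; rewrite !inE /= mem_iota.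
exists L, (fun l => nth x0 (enum F) (val l)).
  move=> l k /eqP; rewrite nth_uniq ?enum_uniq -?cardE ?LP //.
  by move/eqP/val_inj.
apply/setP => x; apply/imsetP/idP => [[l _ ->]|xF].
  by rewrite -mem_enum mem_nth // -cardE LP.
have iL : index x (enum F) \in L.
  by rewrite !inE /= mem_iota /= add0n cardE index_mem mem_enum.
by exists [` iL]%fset; rewrite //= nth_index ?mem_enum.
Qed.

Section MirrorSquare.
Variables (G : sgraph) (phi : G -> G) (A : {set G}).
Hypothesis m : mirror phi A.

(** The graph to be squared is induced on the fixed vertices, which become the labeled ones, and on
    [A]. *)
Let half := {x : G | (phi x == x) || (x \in A)}.

Let half_adj : rel half := fun u v => adj (val u) (val v).

Fact half_adj_sym : symmetric half_adj.
Proof. by move=> u v; apply: adj_sym. Qed.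

Fact half_adj_irr : irreflexive half_adj.
Proof. by move=> u; apply: adj_irr. Qed.

Let half_graph := SGraph half_adj_sym half_adj_irr.

Lemma mirror_square : is_square G.
Proof.
pose F : {set half_graph} := [set u | phi (val u) == val u].
have Fneq0 : F != set0.
  have [x ex] := mirror_fix m; apply/set0Pn.
  have xP : (phi x == x) || (x \in A) by rewrite ex eqxx.
  by exists (Sub x xP); rewrite inE /= ex.
have Fproper : F \proper [set: half_graph].
  have [x xA] := mirror_moved m; apply/properP; split; first exact: subsetT.
  have xP : (phi x == x) || (x \in A) by rewrite xA orbT.
  by exists (Sub x xP); rewrite ?inE //= (negbTE (mirror_neq m xA)).
have [L [th thI thF]] := labels_of_set Fneq0.
have thN : [set th l | l : L] != set0 by rewrite thF.
have thP : [set th l | l : L] \proper [set: half_graph] by rewrite thF.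
pose H := @PLGraph half_graph L th thI thN thP.
have LF (u : H) : (u \in labeled H) = (phi (val u) == val u).
  by rewrite /labeled thF inE.
have LA (u : H) : u \notin labeled H -> val u \in A.
  by rewrite LF => ne; have := valP u; rewrite (negbTE ne).
(* The first copy maps by inclusion, the second by [phi]; they agree on labeled vertices, which
   [phi] fixes. *)
pose k (x : square H) : G :=
  match x with inl v => val v | inr w => phi (val (val w)) end.
have k1 (u : H) : k (copy1 u) = val u by [].
have k2 (u : H) : k (copy2 u) = phi (val u).
  case: (boolP (u \in labeled H)) => uL; last by rewrite /copy2 insubT.
  by rewrite copy2_labeled //=; move: uL; rewrite LF => /eqP.
have kI : injective k.
  case=> [u|w] [u'|w'] /= e.
  - by rewrite (val_inj e).
  (* Here [val u] lies outside [A], hence is fixed; then so is its preimage in [A], which is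
     impossible. *)
  - have := mirror_notin m (LA _ (valP w')); rewrite -e => uA.
    have := valP u; rewrite (negbTE uA) orbF => /eqP.
    rewrite /= e (mirror_inv m) => e'.
    by have := mirror_neq m (LA _ (valP w')); rewrite -e' eqxx.
  - have := mirror_notin m (LA _ (valP w)); rewrite e => uA.
    have := valP u'; rewrite (negbTE uA) orbF => /eqP.
    rewrite /= -e (mirror_inv m) => e'.
    by have := mirror_neq m (LA _ (valP w)); rewrite -e' eqxx.
  - by congr inr; apply/val_inj/val_inj; apply: (inv_inj (mirror_inv m)).
have kS y : exists x, k x = y.
  case: (boolP ((phi y == y) || (y \in A))) => [yP|].
    by exists (inl (Sub y yP)).
  rewrite negb_or => /andP[ne yA].
  have := mirror_cover m ne; rewrite (negbTE yA) /= => fyA.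
  have yP : (phi (phi y) == phi y) || (phi y \in A) by rewrite fyA orbT.
  by exists (copy2 (Sub (phi y) yP : H)); rewrite k2 /= (mirror_inv m).
have [g gK] := fin_all_exists kS.
have kK : cancel k g by move=> x; apply: kI; rewrite gK.
exists H, g; first by exists k.
move=> x y; rewrite -{2}[x]gK -{2}[y]gK; move: (g x) (g y) => {}x {}y.
apply/idP/idP.
  case/existsP=> u /existsP[v /andP[uv /orP[]]] /andP[/eqP-> /eqP->].
    by [].
  by rewrite !k2 (mirror_adjE m).
(* By [mirror_nadj], an edge from the first copy into the unlabeled part of the second starts at a
   fixed vertex; applying [phi] brings it back into [H]. *)
have cross (v : H) (w : {v : H | v \notin labeled H}) :
    adj (val v) (phi (val (val w))) -> adj v (val w) /\ copy2 v = inl v.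
  move=> vw; have wA := LA _ (valP w).
  case: (boolP (v \in labeled H)) => vL; last first.
    by have := mirror_nadj m (LA _ vL) wA; rewrite vw.
  split; last exact: copy2_labeled.
  by move: vL; rewrite LF => /eqP ev; rewrite -ev (mirror_adjE m) in vw.
case: x y => [u|w] [u'|w'] /= h.
- have h' : adj u u' := h.
  by apply/existsP; exists u; apply/existsP; exists u'; rewrite h' !eqxx.
- have [h' e] := cross _ _ h.
  apply/existsP; exists u; apply/existsP; exists (val w').
  by rewrite h' e copy2_val !eqxx orbT.
- have [h' e] : adj u' (val w) /\ copy2 u' = inl u'.
    by apply: cross; rewrite adj_sym.
  apply/existsP; exists (val w); apply/existsP; exists u'.
  by rewrite adj_sym h' e copy2_val !eqxx orbT.
- have h' : adj (val w) (val w') by rewrite (mirror_adjE m) in h.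
  apply/existsP; exists (val w); apply/existsP; exists (val w').
  by rewrite h' !copy2_val !eqxx orbT.
Qed.

End MirrorSquare.

Theorem is_squareP (G : sgraph) :
  is_square G <-> exists phi : G -> G, exists A : {set G}, mirror phi A.
Proof.
split=> [[H GH]|[phi [A m]]]; last exact: mirror_square m.
exact: mirror_iso GH (sq_mirror H).
Qed.

(** Up to loops, [r] is a path on [a], [b], [c], [d], whose only automorphisms are the identity and
    the reversal. *)
Lemma path4_symmetry (T : eqType) (r : rel T) (phi : T -> T) (a b c d : T) :
  injective phi -> symmetric r -> (forall x y, r x y -> r (phi x) (phi y)) ->
  uniq [:: a; b; c; d] ->
  {in [:: a; b; c; d], forall x, phi x \in [:: a; b; c; d]} ->
  r a b -> r b c -> r c d ->
  r a c = false -> r b d = false -> r a d = false ->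
  [/\ phi a = a, phi b = b, phi c = c & phi d = d] \/
  [/\ phi a = d, phi b = c, phi c = b & phi d = a].
Proof.
move=> phiI r_sym phi_r U phi4 ab bc cd ac bd ad.
have ca : r c a = false by rewrite r_sym.
have db : r d b = false by rewrite r_sym.
have da : r d a = false by rewrite r_sym.
have phi_or x : x \in [:: a; b; c; d] ->
    [\/ phi x = a, phi x = b, phi x = c | phi x = d].
  by move/phi4; rewrite !inE => /or4P[] /eqP ->;
    [constructor 1|constructor 2|constructor 3|constructor 4].
have neq x y : x != y -> phi x <> phi y by move=> /eqP xy /phiI.
move: U; rewrite /= !inE !negb_or andbT.
case/and3P=> /and3P[/neq nab /neq nac /neq nad] /andP[/neq nbc /neq nbd] /neq ncd.
have [] : [/\ [\/ phi a = a, phi a = b, phi a = c | phi a = d],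
  [\/ phi b = a, phi b = b, phi b = c | phi b = d],
  [\/ phi c = a, phi c = b, phi c = c | phi c = d] &
  [\/ phi d = a, phi d = b, phi d = c | phi d = d]].
  by split; apply: phi_or; rewrite !inE eqxx ?orbT.
move: (phi_r _ _ ab) (phi_r _ _ bc) (phi_r _ _ cd).
move=> pab pbc pcd ea eb ec ed.
(* The middle edge must go to itself: on an end edge, [phi a] or [phi d] would have to be a second
   neighbour of an end of the path. *)
case: eb => eb; case: ec => ec; rewrite eb ec in pbc; try congruence;
case: ea => ea; rewrite ea eb in pab; try congruence;
case: ed => ed; rewrite ec ed in pcd; try congruence; by [left|right].
Qed.

(** * Common neighbours in the circulant graph *)

#[local] Arguments circ_adj : simpl never.

Section Circulant13.
Variable n : nat.
Hypothesis n7 : 7 <= n.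

Definition shift (k : nat) (x : 'I_n) : 'I_n :=
  Ordinal (ltn_pmod (x + k) (leq_ltn_trans (leq0n x) (ltn_ord x))).

(** Trades the remainder for linear conditions that [lia] can use; as [k <= n], the sum wraps around
    at most once. *)
Lemma shiftP (k : nat) (x : 'I_n) : k <= n ->
  x + k < n /\ shift k x = x + k :> nat \/
  n <= x + k /\ shift k x + n = x + k :> nat.
Proof.
move=> kn; have xn := ltn_ord x; rewrite /=.
case: (ltnP (x + k) n) => h; first by left; rewrite modn_small.
right; split=> //; have -> : x + k = (x + k - n) + n by lia.
by rewrite modnDr modn_small; lia.
Qed.

Lemma circ13E (x y : 'I_n) : circ_adj [:: 1; 3] x y =
  [|| (y == x + 1 :> nat), (y == x + 3 :> nat),
      (x == y + 1 :> nat), (x == y + 3 :> nat),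
      (y + n == x + 1 :> nat), (y + n == x + 3 :> nat),
      (x + n == y + 1 :> nat) | (x + n == y + 3 :> nat)].
Proof.
have n1 : 1 <= n by lia.
have n3 : 3 <= n by lia.
have sh d (z t : 'I_n) : (z + d == t %[mod n]) = (t == shift d z :> nat).
  by rewrite eq_sym /= [t %% n]modn_small.
rewrite /circ_adj /= orbF ![_ == _ + _ %[mod n]]eq_sym !sh.
move: (shiftP x n1) (shiftP x n3) (shiftP y n1) (shiftP y n3).
move: (shift 1 x) (shift 3 x) (shift 1 y) (shift 3 y) => a b c d.
move: (ltn_ord x) (ltn_ord y); lia.
Qed.

(** At least three common neighbours: a relation that automorphisms preserve. *)
Definition rich (x y : 'I_n) : bool :=
  [exists t : 'I_n * 'I_n * 'I_n, uniq [:: t.1.1; t.1.2; t.2] &&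
    all (fun z => circ_adj [:: 1; 3] x z && circ_adj [:: 1; 3] y z)
      [:: t.1.1; t.1.2; t.2]].

Lemma rich_sym : symmetric rich.
Proof.
move=> x y; apply: eq_existsb => t.
by congr (_ && _); apply: eq_all => z; rewrite andbC.
Qed.

Lemma rich_le2 (x y a b : 'I_n) :
  (forall z, circ_adj [:: 1; 3] x z -> circ_adj [:: 1; 3] y z ->
     z = a \/ z = b) -> rich x y = false.
Proof.
move=> ab; apply/negbTE; rewrite /rich; apply/negP => /existsP[[[u v] w]] /=.
rewrite !inE andbT => /andP[/andP[/norP[uv uw] vw]].
move=> /and4P[/andP[xu yu] /andP[xv yv] /andP[xw yw] _].
have [ea|ea] := ab u xu yu; have [eb|eb] := ab v xv yv;
  have [ec|ec] := ab w xw yw; subst; by rewrite eqxx in uv uw vw.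
Qed.

Lemma rich2 (x : 'I_n) : rich x (shift 2 x).
Proof.
have n1 : 1 <= n by lia.
have n2 : 2 <= n by lia.
have n3 : 3 <= n by lia.
(* The third witness is [x - 1], which is also [(x + 2) - 3]. *)
apply/existsP; exists (shift 1 x, shift 3 x, shift (n - 1) x).
rewrite /= !inE -!val_eqE !circ13E.
move: (shiftP x n1) (shiftP x n2) (shiftP x n3) (shiftP x (leq_subr 1 n)).
move: (shift 1 x) (shift 2 x) (shift 3 x) (shift (n - 1) x) => a b c d /=.
move: (ltn_ord x) => xn s1 s2 s3 s4; repeat (apply/andP; split); lia.
Qed.

Hypotheses (n8 : n != 8) (n10 : n != 10).

(** A common neighbour other than [x + 1] and [x + 3] would be one of [x - 1], [x - 3] and also one
    of [x + 5], [x + 7], so [n] would divide 6, 8 or 10. *)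
Lemma rich4 (x : 'I_n) : rich x (shift 4 x) = false.
Proof.
have n1 : 1 <= n by lia.
have n3 : 3 <= n by lia.
have n4 : 4 <= n by lia.
apply: (@rich_le2 _ _ (shift 1 x) (shift 3 x)) => z h1 h2.
suff : z = shift 1 x :> nat \/ z = shift 3 x :> nat by case=> /val_inj; auto.
move: h1 h2 (shiftP x n1) (shiftP x n3) (shiftP x n4).
move: (ltn_ord x) (ltn_ord z); rewrite !circ13E.
move: (shift 1 x) (shift 3 x) (shift 4 x) => a b c; lia.
Qed.

(* For [n = 12] the opposite vertices [x] and [x + 6] have a second common
   neighbour [x - 3]. *)
Lemma rich6 (x : 'I_n) : rich x (shift 6 x) = false.
Proof.
have n3 : 3 <= n by lia.
have n6 : 6 <= n by lia.
apply: (@rich_le2 _ _ (shift 3 x) (shift (n - 3) x)) => z h1 h2.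
suff : z = shift 3 x :> nat \/ z = shift (n - 3) x :> nat
  by case=> /val_inj; auto.
move: h1 h2 (shiftP x n3) (shiftP x n6) (shiftP x (leq_subr 3 n)).
move: (ltn_ord x) (ltn_ord z); rewrite !circ13E.
move: (shift 3 x) (shift 6 x) (shift (n - 3) x) => a b c; lia.
Qed.

Lemma shiftS (i j k : nat) (x : 'I_n) :
  i + j = k %[mod n] -> shift j (shift i x) = shift k x.
Proof.
move=> ijk; apply: val_inj.
by rewrite /= modnDml -addnA -modnDmr ijk modnDmr.
Qed.

Lemma shift_inj (i j : nat) (x : 'I_n) :
  i < n -> j < n -> shift i x = shift j x -> i = j.
Proof.
move=> ni nj /(congr1 val) /= /eqP.
by rewrite eqn_modDl !modn_small // => /eqP.
Qed.

(** Listed so that consecutive entries differ by 2: in this order they form a path for [rich]. *)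
Definition neighbours13 (x : 'I_n) : seq 'I_n :=
  [:: shift (n - 3) x; shift (n - 1) x; shift 1 x; shift 3 x].

Lemma uniq_neighbours13 (x : 'I_n) : uniq (neighbours13 x).
Proof.
have ne i j : i < n -> j < n -> i != j -> shift i x != shift j x.
  by move=> ni nj; apply: contra_neq; apply: shift_inj.
by rewrite /= !inE !negb_or !ne //; lia.
Qed.

Lemma mem_neighbours13 (x y : 'I_n) :
  (y \in neighbours13 x) = circ_adj [:: 1; 3] x y.
Proof.
have shE d (z t : 'I_n) : (z + d == t %[mod n]) = (t == shift d z).
  by rewrite eq_sym -val_eqE /= [t %% n]modn_small.
have shN d : d <= n -> (x == shift d y) = (y == shift (n - d) x).
  move=> dn; move: (shiftP y dn) (shiftP x (leq_subr d n)).
  move: (shift _ y) (shift _ x) => a b.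
  have := ltn_ord x; have := ltn_ord y; rewrite -!val_eqE /=; lia.
rewrite /circ_adj /= orbF ![_ == _ + _ %[mod n]]eq_sym !shE !shN; try lia.
by rewrite !inE; do 4 case: (y == _).
Qed.

(** * No mirror when [n] is neither 8 nor 10 *)

Section NoMirror.
Hypothesis dsP : circulant_steps n [:: 1; 3].
Variables (phi : circulant dsP -> circulant dsP) (A : {set circulant dsP}).
Hypothesis m : mirror phi A.

Let phiI : injective phi := inv_inj (mirror_inv m).

Lemma rich_mirror (x y : 'I_n) : rich x y -> rich (phi x) (phi y).
Proof.
case/existsP=> -[[u v] w] /= /andP[U xyuvw].
apply/existsP; exists (phi u, phi v, phi w).
have adjE s t : circ_adj [:: 1; 3] (phi s) (phi t) = circ_adj [:: 1; 3] s t.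
  exact: (mirror_adjE m).
rewrite /= !adjE xyuvw andbT.
by move: U; rewrite !inE !(inj_eq phiI).
Qed.

(** [phi] permutes the neighbours of [f] and preserves [rich], which holds between them at
    difference 2 and fails at differences 4 and 6. *)
Lemma neighbours13_symmetry (f : 'I_n) : phi f = f ->
  [/\ phi (shift (n - 3) f) = shift (n - 3) f,
      phi (shift (n - 1) f) = shift (n - 1) f,
      phi (shift 1 f) = shift 1 f & phi (shift 3 f) = shift 3 f] \/
  [/\ phi (shift (n - 3) f) = shift 3 f,
      phi (shift (n - 1) f) = shift 1 f,
      phi (shift 1 f) = shift (n - 1) f & phi (shift 3 f) = shift (n - 3) f].
Proof.
move=> ef.
have wrap i j k : i <= n -> n - i + j = n + k ->
    shift j (shift (n - i) f) = shift k f.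
  by move=> ni e; apply: shiftS; rewrite e modnDl.
apply: (@path4_symmetry 'I_n rich phi) => //.
- exact: rich_sym.
- exact: rich_mirror.
- exact: uniq_neighbours13.
- by move=> x; rewrite !mem_neighbours13 -{2}ef; apply: (mirror_adj m).
- have := rich2 (shift (n - 3) f); rewrite (@shiftS _ _ (n - 1)) //.
  by congr (_ %% _); lia.
- by have := rich2 (shift (n - 1) f); rewrite (wrap _ _ 1) //; lia.
- by have := rich2 (shift 1 f); rewrite (@shiftS _ _ 3).
- by have := rich4 (shift (n - 3) f); rewrite (wrap _ _ 1) //; lia.
- by have := rich4 (shift (n - 1) f); rewrite (wrap _ _ 3) //; lia.
- by have := rich6 (shift (n - 3) f); rewrite (wrap _ _ 3) //; lia.
Qed.

(** [x] and [phi x] lie on opposite sides, so if [y] were moved, one of its edges to them would join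
    the two sides. *)
Lemma between_sides_fixed (x y : circulant dsP) :
  phi x != x -> adj x y -> adj (phi x) y -> phi y = y.
Proof.
move=> xA xy pxy; apply/eqP; apply: contraT => yA.
have {xA yA} := (mirror_cover m xA, mirror_cover m yA).
case=> /orP[] hx /orP[] hy.
- by have := mirror_nadj m hy hx; rewrite adj_sym pxy.
- by have := mirror_nadj m hx hy; rewrite (mirror_inv m) xy.
- by have := mirror_nadj m hy hx; rewrite (mirror_inv m) adj_sym xy.
- by have := mirror_nadj m hx hy; rewrite (mirror_inv m) pxy.
Qed.

Lemma fixed_shift1 (f : 'I_n) : phi f = f -> phi (shift 1 f) = shift 1 f.
Proof.
move=> ef; have [[]//|[_ _ ec _]] := neighbours13_symmetry ef.
have neq i : i < n - 1 -> shift (n - 1) f <> shift i f.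
  by move=> ni /shift_inj; lia.
have e1 : shift (n - 1) (shift 2 f) = shift 1 f.
  by apply: shiftS; rewrite (_ : 2 + (n - 1) = n + 1) ?modnDl //; lia.
have e3 : shift (n - 3) (shift 2 f) = shift (n - 1) f.
  by apply: shiftS; congr (_ %% _); lia.
have e2 : phi (shift 2 f) = shift 2 f.
  apply: (@between_sides_fixed (shift 1 f)); rewrite ?ec.
  - by apply/eqP/neq; lia.
  - by rewrite adj_sym -e1 /= -mem_neighbours13 !inE eqxx !orbT.
  - by rewrite adj_sym -e3 /= -mem_neighbours13 !inE eqxx.
(* Since [phi] sends [f + 1] to [f - 1], fixing the path around [f + 2] would give [f - 1 = f + 1],
   and reversing it [f - 1 = f + 3]. *)
have [[_]|[_]] := neighbours13_symmetry e2; rewrite e1 ec.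
  by move/neq; lia.
by rewrite (@shiftS _ _ 3) // => /neq; lia.
Qed.

Lemma no_mirror13 : False.
Proof.
have [f ef] := mirror_fix m; have [x xA] := mirror_moved m.
have fixk k : phi (shift k f) = shift k f.
  elim: k => [|k IHk].
    suff -> : shift 0 f = f by [].
    by apply: val_inj; rewrite /= addn0 modn_small.
  by have := fixed_shift1 IHk; rewrite (@shiftS _ _ k.+1) // addn1.
(* The shift is [x - f] modulo [n]; adding [n] first keeps the subtraction from truncating. *)
have ex : x = shift (n - f + x) f.
  apply: val_inj => /=; rewrite addnA subnKC; last exact: ltnW.
  by rewrite modnDl modn_small.
by have := mirror_neq m xA; rewrite ex fixk eqxx.
Qed.

End NoMirror.

End Circulant13.

(** * Explicit mirrors for [n = 8] and [n = 10] *)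

Definition ord_table (n : nat) (t : seq nat) (x : 'I_n.+1) : 'I_n.+1 :=
  Ordinal (ltn_pmod (nth 0 t x) (ltn0Sn n)).

(** Vertices 0 and 2 are both adjacent to exactly the odd vertices, so they can be exchanged. *)
Lemma mirror8 (dsP : circulant_steps 8 [:: 1; 3]) :
  @mirror (circulant dsP) (@ord_table 7 [:: 2; 1; 0; 3; 4; 5; 6; 7])
    [set x : 'I_8 | val x \in [:: 0]].
Proof.
split.
- by move=> x; apply: val_inj; case: x => [[|[|[|[|[|[|[|[|x]]]]]]]] ?].
- by case=> [[|[|[|[|[|[|[|[|x]]]]]]]] ?] [[|[|[|[|[|[|[|[|y]]]]]]]] ?].
- by case=> [[|[|[|[|[|[|[|[|x]]]]]]]] ?]; rewrite !inE.
- by case=> [[|[|[|[|[|[|[|[|x]]]]]]]] ?]; rewrite !inE.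
- by case=> [[|[|[|[|[|[|[|[|x]]]]]]]] ?] [[|[|[|[|[|[|[|[|y]]]]]]]] ?];
    rewrite !inE.
- by exists (Ordinal (isT : 1 < 8)); apply: val_inj.
- by exists (Ordinal (isT : 0 < 8)); rewrite inE.
Qed.

(** The matched pairs 0, 5 and 2, 7 are exchanged. The side takes one vertex from each pair, since 0
    is adjacent to 7, the image of 5. *)
Lemma mirror10 (dsP : circulant_steps 10 [:: 1; 3]) :
  @mirror (circulant dsP) (@ord_table 9 [:: 2; 1; 0; 3; 4; 7; 6; 5; 8; 9])
    [set x : 'I_10 | val x \in [:: 0; 7]].
Proof.
split.
- by move=> x; apply: val_inj; case: x => [[|[|[|[|[|[|[|[|[|[|x]]]]]]]]]] ?].
- by case=> [[|[|[|[|[|[|[|[|[|[|x]]]]]]]]]] ?]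
    [[|[|[|[|[|[|[|[|[|[|y]]]]]]]]]] ?].
- by case=> [[|[|[|[|[|[|[|[|[|[|x]]]]]]]]]] ?]; rewrite !inE.
- by case=> [[|[|[|[|[|[|[|[|[|[|x]]]]]]]]]] ?]; rewrite !inE.
- by case=> [[|[|[|[|[|[|[|[|[|[|x]]]]]]]]]] ?]
    [[|[|[|[|[|[|[|[|[|[|y]]]]]]]]]] ?]; rewrite !inE.
- by exists (Ordinal (isT : 1 < 10)); apply: val_inj.
- by exists (Ordinal (isT : 0 < 10)); rewrite inE.
Qed.

Theorem theorem4p11 (n : nat) (hn : 7 <= n) :
  (n \in [:: 8; 10] -> is_square (circulant (circulant_steps13 hn))) /\
  (n \notin [:: 8; 10] -> ~ is_square (circulant (circulant_steps13 hn))).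
Proof.
rewrite !inE negb_or; split.
  case/orP=> /eqP e; subst n.
    exact: mirror_square (mirror8 _).
  exact: mirror_square (mirror10 _).
case/andP=> n8 n10 /is_squareP[phi [A m]].
exact: (no_mirror13 hn n8 n10 m).
Qed.
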